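(* For every integer $n\geq 3$, there exist a temporal cycle $\mathcal{C}$ with $n$ vertices and lifetime $L=2n-3$, and a starting vertex $s$, such that there is exactly one exploration of $\mathcal{C}$ starting at $s$, and this exploration traverses $2n-3$ edges.
   Context: A temporal graph $\mathcal{G}$ with (finite) vertex set $V$, $|V|=n$, and lifetime $L$ is a sequence $(G_1,\dots,G_L)$ of static undirected graphs $G_i=(V,E_i)$; $G_i$ is the snapshot at time step $i$. All temporal graphs are assumed constantly connected: every $G_i$ is connected. The underlying graph is $(V,\bigcup_i E_i)$. A temporal cycle is a (constantly connected) temporal graph whose underlying graph is a cycle on the $n\ge 3$ vertices. A (strict) journey from $u$ to $v$ is a sequence $((v_0,v_1),t_1),\dots,((v_{l-1},v_l),t_l)$ with $v_0=u$, $v_l=v$, $1\le t_1<t_2<\dots<t_l\le L$ (not necessarily consecutive) and $\{v_{i-1},v_i\}\in E_{t_i}$ for all $i$. The number of edges traversed is $l$, counted with multiplicity. The journey visits the vertices $v_0,\dots,v_l$. An exploration starting at $s$ is a strict journey with $v_0=s$ that visits all vertices of $V$. *)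

(* Defs.v *)
From mathcomp Require Import all_boot.

Set Implicit Arguments.
Unset Strict Implicit.
Unset Printing Implicit Defensive.

Record simple_graph (V : finType) := SimpleGraph {
  adj :> rel V;
  adj_sym : symmetric adj;
  adj_irr : irreflexive adj
}.

Definition connected_graph (V : finType) (e : rel V) : Prop :=
  forall x y : V, connect e x y.

(* The successor of the last vertex of [c] under [next c] is its first one. *)
Definition is_cycle_graph (V : finType) (e : rel V) : Prop :=
  exists c : seq V,
    [/\ uniq c, 3 <= size c, forall x : V, x \in c
      & forall x y : V, e x y = (y == next c x) || (x == next c y)].

(* Time steps are the elements of ['I_L]: the [t : 'I_L] of value [k] stands
   for the time step [k.+1] among [1, ..., L]. *)
Definition temporal_graph (V : finType) (L : nat) := L.-tuple (simple_graph V).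

Definition snapshot (V : finType) (L : nat) (G : temporal_graph V L)
  (t : 'I_L) : simple_graph V := tnth G t.

Definition constantly_connected (V : finType) (L : nat)
  (G : temporal_graph V L) : Prop :=
  forall t : 'I_L, connected_graph (snapshot G t).

Definition underlying (V : finType) (L : nat) (G : temporal_graph V L) : rel V :=
  [rel x y | [exists t : 'I_L, snapshot G t x y]].

Definition temporal_cycle (V : finType) (L : nat)
  (G : temporal_graph V L) : Prop :=
  constantly_connected G /\ is_cycle_graph (underlying G).

(* The entry [((x, y), t)] crosses the edge {x, y} from x to y at time t. *)
Definition time_edge (V : finType) (L : nat) : finType := (V * V * 'I_L)%type.

Definition sources (V : finType) (L : nat) (j : seq (time_edge V L)) : seq V :=
  [seq e.1.1 | e <- j].

Definition targets (V : finType) (L : nat) (j : seq (time_edge V L)) : seq V :=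
  [seq e.1.2 | e <- j].

Definition times (V : finType) (L : nat) (j : seq (time_edge V L)) : seq nat :=
  [seq val e.2 | e <- j].

(* The first conjunct says that both sides list the vertices v_0, ..., v_l:
   the entries are consecutive, v_0 = u and v_l = v. *)
Definition journey (V : finType) (L : nat) (G : temporal_graph V L)
  (u v : V) (j : seq (time_edge V L)) : Prop :=
  [/\ u :: targets j = rcons (sources j) v,
      sorted ltn (times j)
    & forall e : time_edge V L, e \in j -> snapshot G e.2 e.1.1 e.1.2].

Definition visits (V : finType) (L : nat) (u : V) (j : seq (time_edge V L))
  (x : V) : Prop := x \in u :: targets j.

Definition exploration (V : finType) (L : nat) (G : temporal_graph V L)
  (s : V) (j : seq (time_edge V L)) : Prop :=
  (exists v : V, journey G s v j) /\ (forall x : V, visits s j x).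

(* Main.v *)
Require Import Defs.
From mathcomp Require Import all_boot zify.

(** On the cycle 0, 1, ..., n-1 the edge {n-1, 0} is missing during the first
    n-2 steps and the edge {n-2, n-1} during the last n-1 steps. From 0, the
    vertex n-1 is out of reach in the first phase, and n-2 is reached there only
    by moving forward at every step. In the second phase the graph is the path
    n-1, 0, 1, ..., n-2, so an agent that has not reached n-2 yet would start
    strictly inside this path and would have to visit both of its ends, which
    takes more than n-1 steps. Hence the agent starts the second phase at n-2
    and needs all n-1 steps to reach n-1. *)

Set Implicit Arguments.
Unset Strict Implicit.
Unset Printing Implicit Defensive.

(** * Path graphs given by a coordinate on the vertices *)

Section PathGraph.
Variables (V : finType) (f : V -> nat).

Definition path_rel : rel V := fun x y => (f y == (f x).+1) || (f x == (f y).+1).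

Lemma path_rel_sym : symmetric path_rel.
Proof. by move=> x y; apply: orbC. Qed.

Lemma path_rel_irr : irreflexive path_rel.
Proof. by move=> x; rewrite /path_rel ltn_eqF. Qed.

Definition path_graph := SimpleGraph path_rel_sym path_rel_irr.

(** [g] lists the vertices in path order, so climbing from [g 0] reaches each of them. The bound
    [k <= f x] restricts [k] to coordinates that really occur. *)
Lemma path_graph_connected (g : nat -> V) :
  (forall x k, k <= f x -> f (g k) = k) -> (forall x, g (f x) = x) ->
  connected_graph path_graph.
Proof.
move=> fg gf.
have c0 x : connect path_rel (g 0) x.
  suff H k : k <= f x -> connect path_rel (g 0) (g k) by rewrite -(gf x) H.
  elim: k => [//|k IH] kx; apply: connect_trans (IH (ltnW kx)) (connect1 _).
  by rewrite /path_rel (fg x) // (fg x) ?eqxx // ltnW.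
move=> x y; apply: connect_trans (c0 y).
by rewrite (sym_connect_sym path_rel_sym).
Qed.

End PathGraph.

(** * Time bounds for journeys on a fixed path *)

Section Journeys.
Variables (V : finType) (L : nat).
Implicit Types (j : seq (time_edge V L)) (G : temporal_graph V L) (e : time_edge V L).

(** The form stable under induction: removing a first entry of time [t] leaves a journey with bound
    [t.+1]. The bound may lie below the first time, which models waiting. *)
Definition journey_from G (k : nat) (u : V) j : Prop :=
  (exists v, journey G u v j) /\ all (leq k) (times j).

Lemma journey_from_cons G k u e j : journey_from G k u (e :: j) ->
  [/\ e.1.1 = u, k <= e.2, snapshot G e.2 u e.1.2
    & journey_from G e.2.+1 e.1.2 j].
Proof.
case=> -[v [/= [-> Ev] srt adje] /andP[ke _]]; split=> //.
  by apply: adje; rewrite mem_head.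
split; last exact: order_path_min ltn_trans srt.
exists v; split=> //; first exact: path_sorted srt.
by move=> e' je'; apply: adje; rewrite inE je' orbT.
Qed.

(** A move changes [f] by one, and at most [L - k] moves remain. *)
Lemma journey_from_path G (f : V -> nat) (p k : nat) u j x :
  (forall t : 'I_L, p <= t -> snapshot G t =2 path_rel f) ->
  p <= k -> k <= L -> journey_from G k u j -> visits u j x ->
  f u <= f x + (L - k) /\ f x <= f u + (L - k).
Proof.
move=> Gf; elim: j k u => [|e j IH] k u pk kL.
  by move=> _; rewrite /visits inE => /eqP->; lia.
case/journey_from_cons=> _ ke; rewrite Gf 1?(leq_trans pk) // /path_rel => adje Jj.
rewrite /visits inE => /predU1P[->|xj]; first by lia.
have eL := ltn_ord e.2.
have := IH _ _ _ eL Jj xj; lia.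
Qed.

(** Whichever end comes first costs at least the distance to the nearer one; the whole path, of
    length [M], must then be crossed. *)
Lemma journey_from_path_ends G (f : V -> nat) (p k M : nat) u j x y :
  (forall t : 'I_L, p <= t -> snapshot G t =2 path_rel f) ->
  p <= k -> k <= L -> journey_from G k u j -> visits u j x -> visits u j y ->
  f x = 0 -> f y = M -> f u <= M -> M + minn (f u) (M - f u) <= L - k.
Proof.
move=> Gf + + + + + fx fy.
elim: j k u => [|e j IH] k u pk kL.
  move=> _; rewrite /visits !inE => /eqP<- /eqP yx.
  by move: fx fy; rewrite yx; lia.
move=> J ux uy uM; have Lx := journey_from_path Gf pk kL J ux.
have Ly := journey_from_path Gf pk kL J uy; move: ux uy.
case/journey_from_cons: J => _ ke; rewrite Gf 1?(leq_trans pk) // /path_rel => adje Jj.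
have eL := ltn_ord e.2.
rewrite /visits inE => /predU1P[xu|xj]; first by subst x; lia.
rewrite inE => /predU1P[yu|yj]; first by subst y; lia.
(* A move beyond [M] forces [f u = M]; the minimum is then 0 and [Lx] gives the bound. *)
have [eM|] := leqP (f e.1.2) M; last by lia.
have := IH _ _ _ eL Jj xj yj eM; lia.
Qed.

End Journeys.

(** * The two-phase cycle and the agent's route *)

Section Construction.
Variable m : nat.
Local Notation n := m.+3.
Local Notation L := (2 * n - 3).

Definition coord1 (x : 'I_n) : nat := x.
(** Position along the second-phase path n-1, 0, 1, ..., n-2. *)
Definition coord2 (x : 'I_n) : nat := if x == n.-1 :> nat then 0 else x.+1.

Definition two_phase_cycle : temporal_graph 'I_n L :=
  [tuple if t < n.-2 then path_graph coord1 else path_graph coord2 | t < L].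

(** The vertex held just before step [k], counted from 0: forward up to n-2, then back to 0, and
    across to n-1 at the last step. Time [L] is separate because [L - k - 1] truncates to 0
    there. *)
Definition agent_position (k : nat) : 'I_n :=
  inord (if k <= n.-2 then k else if k == L then n.-1 else L - k - 1).

Definition agent_step (t : 'I_L) : time_edge 'I_n L :=
  ((agent_position t, agent_position t.+1), t).

Lemma snapshot_phase1 (t : 'I_L) : t < n.-2 ->
  snapshot two_phase_cycle t =2 path_rel coord1.
Proof. by move=> tn x y; rewrite /snapshot tnth_mktuple tn. Qed.

Lemma snapshot_phase2 (t : 'I_L) : n.-2 <= t ->
  snapshot two_phase_cycle t =2 path_rel coord2.
Proof. by move=> tn x y; rewrite /snapshot tnth_mktuple ltnNge tn. Qed.

Lemma coord1_agent_position k : k <= n.-2 -> coord1 (agent_position k) = k.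
Proof.
by move=> kn; rewrite /coord1 /agent_position kn inordK //; lia.
Qed.

Lemma coord2_agent_position k : n.-2 <= k -> k <= L ->
  coord2 (agent_position k) = L - k.
Proof.
rewrite /coord2 /agent_position => nk kL.
by case: (leqP k) => ?; last case: (eqVneq k) => ?; rewrite inordK; try case: eqP; lia.
Qed.

Lemma coord2_inj : injective coord2.
Proof.
move=> x y; have := ltn_ord x; have := ltn_ord y.
rewrite /coord2 => xn yn E; apply: val_inj => /=.
by move: E; do 2!case: eqP; lia.
Qed.

Lemma two_phase_cycle_connected : constantly_connected two_phase_cycle.
Proof.
move=> t; rewrite /snapshot tnth_mktuple; case: ifP => _.
  apply: (@path_graph_connected _ _ inord) => x.
    by move=> k kx; rewrite /coord1 inordK // (leq_ltn_trans kx (ltn_ord x)).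
  by rewrite /coord1 inord_val.
apply: (@path_graph_connected _ _ (fun k => inord (if k == 0 then n.-1 else k.-1))).
  move=> x k; have := ltn_ord x; rewrite /coord2 => xn kx.
  by case: (eqVneq k 0) => ?; rewrite inordK; try case: eqP; move: kx; case: eqP; lia.
move=> x; have := ltn_ord x; rewrite /coord2 => xn; apply: val_inj => /=.
by case: (eqVneq (x : nat)) => ?; rewrite /= inordK; lia.
Qed.

Lemma next_enum_ord (x y : 'I_n) :
  (y == next (enum 'I_n) x) = (y == (if x == n.-1 :> nat then 0 else x.+1) :> nat).
Proof.
rewrite next_nth mem_enum inE index_enum_ord -val_eqE /=.
case E: (enum 'I_n) => [|z s]; first by have := size_enum_ord n; rewrite E.
have sz : size s = n.-1 by have := size_enum_ord n; rewrite E => -[].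
have z0 : z = 0 :> nat by rewrite -[z]/(nth z (z :: s) 0) -E nth_enum_ord.
have xn := ltn_ord x; congr (_ == _); case: ifP => [/eqP xE|xE].
  (* The last vertex indexes past the end of [s], and the default [z] is the first vertex, as the
     cycle requires. *)
  by rewrite nth_default // sz xE.
rewrite -[nth z s x]/(nth z (z :: s) x.+1) -E nth_enum_ord //.
lia.
Qed.

Lemma two_phase_cycle_underlying : is_cycle_graph (underlying two_phase_cycle).
Proof.
exists (enum 'I_n); split; first exact: enum_uniq.
- by rewrite size_enum_ord.
- by move=> x; rewrite mem_enum.
move=> x y; rewrite !next_enum_ord.
have xn := ltn_ord x; have yn := ltn_ord y.
apply/existsP/idP => [[t]|xy].
  have [tn|tn] := ltnP t n.-2.
    rewrite (snapshot_phase1 tn) /path_rel /coord1 /=; move: xn yn.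
    case: (eqVneq (x : nat) m.+2) => ?; case: (eqVneq (y : nat) m.+2) => ?; lia.
  rewrite (snapshot_phase2 tn) /path_rel /coord2 /=; move: xn yn.
  by case: (eqVneq (x : nat) m.+2) => ?; case: (eqVneq (y : nat) m.+2) => ?; lia.
have L0 : 0 < L by lia.
have L1 : L.-1 < L by lia.
(* Every cycle edge except {n-1, 0} is present at the first step; that one is present at the
   last. *)
case E: (path_rel coord1 x y).
  by exists (Ordinal L0); rewrite snapshot_phase1.
exists (Ordinal L1); rewrite snapshot_phase2 /=; last by lia.
move: E xy xn yn; rewrite /path_rel /coord1 /coord2 /=.
by case: (eqVneq (x : nat) m.+2) => ?; case: (eqVneq (y : nat) m.+2) => ?; lia.
Qed.

(** * Forced moves and uniqueness *)

Definition agent_tail (k : nat) (j : seq (time_edge 'I_n L)) : Prop :=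
  times j = iota k (L - k) /\ {in j, forall e, e = agent_step e.2}.

Lemma agent_tail_cons k (e : time_edge 'I_n L) j :
  k <= e.2 -> e.2 <= k -> e = agent_step e.2 ->
  agent_tail e.2.+1 j -> agent_tail k (e :: j).
Proof.
move=> ke ek Ee [tj sj]; have {ke ek}-> : k = e.2 by lia.
split=> [|e']; last by rewrite inE => /predU1P[->|/sj].
have eL := ltn_ord e.2.
  by rewrite /= tj (_ : L - e.2 = (L - e.2.+1).+1) //; lia.
Qed.

(** The end [x] is at least as far away as the number of steps left, so no step can be spent waiting
    or moving away from it. *)
Lemma phase2_journey_unique k u j x :
  n.-2 <= k -> k <= L -> journey_from two_phase_cycle k u j -> visits u j x ->
  coord2 x = 0 -> L - k <= coord2 u -> coord2 u = L - k /\ agent_tail k j.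
Proof.
move=> + + + + x0; elim: j k u => [|e j IH] k u nk kL.
  move=> _; rewrite /visits inE => /eqP<-; rewrite x0 leqn0 => /eqP Lk.
  by rewrite /agent_tail Lk.
case/journey_from_cons=> eu ke; have ne := leq_trans nk ke.
have eL := ltn_ord e.2.
rewrite snapshot_phase2 // /path_rel => adje Jj.
rewrite /visits inE => /predU1P[xu|xj] ku; first by subst x; lia.
have [|ey tj] := IH _ _ (leqW ne) eL Jj xj; first by lia.
(* By induction the next vertex has coordinate [L - e.2.+1], so [coord2 u] is at most [L - e.2];
   with [ku] this excludes a wait. *)
have [uk ek] : coord2 u = L - k /\ e.2 <= k by lia.
split=> //; apply: agent_tail_cons => //.
case: e eu ke ne eL adje Jj xj ey tj ek => [[a b] t] /= -> kt nt tL _ _ _ bt _ tk.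
congr (_, _, _); apply: coord2_inj; rewrite coord2_agent_position ?bt //; lia.
Qed.

(** The invariant [u <= k] says that the agent advances at most one vertex per step. Any delay would
    make it strict, and n-2 would be missed at the change of phase. *)
Lemma journey_unique k u j x y :
  k <= n.-2 -> journey_from two_phase_cycle k u j -> visits u j x -> visits u j y ->
  coord2 x = 0 -> coord2 y = n.-1 -> u <= k -> u = k :> nat /\ agent_tail k j.
Proof.
move=> + + + + x0 yM; elim: j k u => [|e j IH] k u kn.
  by move=> _; rewrite /visits !inE => /eqP<- /eqP yx; move: yM; rewrite yx x0.
have kL : n.-2 <= L by lia.
have xE : x = n.-1 :> nat by move: x0; rewrite /coord2; case: eqP.
have yE : y = n.-2 :> nat by move: yM; rewrite /coord2; case: eqP => // _ [].
move=> J ux uy uk.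
case: (journey_from_cons J) => eu ke; have [tn|nt] := ltnP e.2 n.-2.
  rewrite snapshot_phase1 // /path_rel => adje Jj.
  move: ux uy; rewrite /visits !inE => /predU1P[xu|xj].
    by move: xE; rewrite xu; lia.
  case/predU1P=> [yu|yj]; first by move: yE; rewrite yu; lia.
  have [|ey tj] := IH _ _ tn Jj xj yj; first by rewrite /coord1 in adje; lia.
  have [uE ek] : u = k :> nat /\ e.2 <= k by rewrite /coord1 in adje; lia.
  split=> //; apply: agent_tail_cons => //.
  case: e eu ke tn adje Jj xj yj ey tj ek {J} => [[a b] t] /= -> kt tn _ _ _ _ bt _ tk.
  by congr (_, _, _); apply: val_inj; rewrite /= -[RHS]/(coord1 _)
    coord1_agent_position //; lia.
move=> _ Jj.
(* The first move falls in the second phase, so the agent waits at [u] until step n-2 and the bound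
   on visiting both ends applies from there. *)
have J2 : journey_from two_phase_cycle n.-2 u (e :: j).
  case: J => Jv _; split=> //=; rewrite nt /=.
  case: Jj => _; apply: sub_all => t; apply: leq_trans; exact: leqW.
have un : coord2 u = u.+1 by rewrite /coord2 ifN //; lia.
have uM : coord2 u <= n.-1 by rewrite un; lia.
have := journey_from_path_ends (@snapshot_phase2) (leqnn _) kL J2 ux uy x0 yM uM.
rewrite un => uends.
(* Only n-1 steps remain, the full path length, so [u] is an end; its coordinate [u.+1] is nonzero,
   which leaves n-2. *)
have uE : u = n.-2 :> nat by lia.
have kE : k = n.-2 by lia.
split; first by rewrite uE kE.
rewrite kE; apply: (phase2_journey_unique (leqnn _) kL J2 ux x0 _).2.
by rewrite un uE; lia.
Qed.

(** * The unique exploration *)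

Definition agent_journey : seq (time_edge 'I_n L) := map agent_step (enum 'I_L).

(** Each entry is a function of its time, so the list of times determines [j]. *)
Lemma agent_tail0 j : agent_tail 0 j -> j = agent_journey.
Proof.
rewrite /agent_tail subn0 => -[tj sj].
have -> : j = map agent_step (map snd j).
  by rewrite -map_comp; apply/esym/map_id_in => e /sj.
congr map; apply: (inj_map val_inj).
by rewrite val_enum_ord -tj -map_comp.
Qed.

Lemma agent_position0 : agent_position 0 = ord0.
Proof. by apply: val_inj; rewrite /= inordK. Qed.

Lemma agent_targets :
  ord0 :: targets agent_journey = map agent_position (iota 0 L.+1).
Proof.
rewrite /= agent_position0 /targets -map_comp; congr cons.
rewrite (iotaDl 1) -val_enum_ord -!map_comp; exact: eq_map.
Qed.

Lemma agent_journey_exploration : exploration two_phase_cycle ord0 agent_journey.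
Proof.
have L0 : n.-2 < L by lia.
split; last first.
  move=> x; rewrite /visits agent_targets; have xn := ltn_ord x.
  (* The vertex n-1 is met at time [L], any other vertex [x] at time [x] on the way forward. *)
  have [xE|xE] := eqVneq (x : nat) n.-1; apply/mapP.
    exists L; first by rewrite mem_iota /=.
    apply: coord2_inj; rewrite coord2_agent_position ?subnn ?(ltnW L0) //.
    by rewrite /coord2 xE eqxx.
  exists (x : nat); first by rewrite mem_iota /=; move: xn; lia.
  apply: val_inj; rewrite /= -[RHS]/(coord1 _) coord1_agent_position //.
  by move: xn xE; lia.
exists (agent_position L); split.
- rewrite agent_targets -[L.+1]addn1 iotaD map_cat /= cats1; congr rcons.
  by rewrite -val_enum_ord /sources -!map_comp; apply: eq_map.
- have -> : times agent_journey = iota 0 L.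
    by rewrite -val_enum_ord /times -!map_comp; apply: eq_map.
  exact: iota_ltn_sorted.
move=> _ /mapP[t _ ->] /=; have tL := ltn_ord t.
have [tn|tn] := ltnP t n.-2.
  by rewrite snapshot_phase1 // /path_rel /= !coord1_agent_position ?eqxx // ltnW.
rewrite snapshot_phase2 // /path_rel /= !coord2_agent_position //; lia.
Qed.

Lemma agent_journey_unique j :
  exploration two_phase_cycle ord0 j -> j = agent_journey.
Proof.
case=> Jj vj; apply: agent_tail0.
have J0 : journey_from two_phase_cycle 0 ord0 j by split=> //; apply/allP.
have n1 : n.-1 < n by [].
have n2 : n.-2 < n by [].
apply: (journey_unique (leq0n _) J0 (vj (Ordinal n1)) (vj (Ordinal n2)) _ _ _).2 => //.
  by rewrite /coord2 /= eqxx.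
by rewrite /coord2 /= ifN //; lia.
Qed.

End Construction.

Theorem lemma18 (n : nat) (hn : 3 <= n) :
  exists (V : finType) (C : temporal_graph V (2 * n - 3)) (s : V),
    [/\ #|V| = n,
        temporal_cycle C
      & exists j : seq (time_edge V (2 * n - 3)),
          unique (exploration C s) j /\ size j = 2 * n - 3].
Proof.
case: n hn => [|[|[|m]]] // _.
exists 'I_m.+3, (two_phase_cycle m), ord0; split; first exact: card_ord.
  by split; [apply: two_phase_cycle_connected | apply: two_phase_cycle_underlying].
exists (agent_journey m); split; last by rewrite size_map size_enum_ord.
split; first exact: agent_journey_exploration.
by move=> j /agent_journey_unique.
Qed.
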